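(* A Cayley permutation $\pi$ is hare pop-stack sortable if and only if $\pi$ avoids $231$, $312$ and $2121$.
   Context: A Cayley permutation is a finite word $\pi=\pi_1\cdots\pi_n$ over the positive integers such that every integer from $1$ to $\max(\pi)$ occurs at least once. A word contains a pattern $p=p_1\cdots p_k$ if it has a subsequence $x_{i_1}\cdots x_{i_k}$ with $x_{i_u}<x_{i_v}$ iff $p_u<p_v$ and $x_{i_u}=x_{i_v}$ iff $p_u=p_v$; otherwise it avoids $p$. A hare pop-stack processes an input from left to right with a right-greedy algorithm: while the input is nonempty, the next input element is pushed if the resulting stack contents, read from top to bottom, avoid the pattern $21$ (i.e. are weakly increasing from top to bottom); otherwise a pop operation is performed, which removes all elements of the stack, appending them to the output in order from top to bottom. When the input is exhausted, the stack is emptied in the same way. $\pi$ is hare pop-stack sortable if the output on input $\pi$ is weakly increasing. *)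

(* Defs.v *)
From mathcomp Require Import all_boot.

Set Implicit Arguments.
Unset Strict Implicit.
Unset Printing Implicit Defensive.

(* The empty word is included. *)
Definition cayley_permutation (w : seq nat) : bool :=
  all (fun x => 0 < x) w && all (fun k => k \in w) (iota 1 (\max_(x <- w) x)).

Definition order_isomorphic (s p : seq nat) : bool :=
  (size s == size p) &&
  all2rel (fun u v =>
      ((nth 0 s u < nth 0 s v) == (nth 0 p u < nth 0 p v)) &&
      ((nth 0 s u == nth 0 s v) == (nth 0 p u == nth 0 p v)))
    (iota 0 (size p)).

Definition contains (w p : seq nat) : bool :=
  [exists m : (size w).-tuple bool, order_isomorphic (mask m w) p].

Definition avoids (w p : seq nat) : bool := ~~ contains w p.

Lemma containsP w p :
  reflect (exists2 s, subseq s w & order_isomorphic s p) (contains w p).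
Proof.
apply: (iffP existsP) => [[m iso]|[s /subseqP[m /eqP sz ->] iso]].
  by exists (mask m w) => //; apply: mask_subseq.
by exists (Tuple sz).
Qed.

(* The output produced from the current stack and the remaining input; the    *)
(* head of [stack] is its top. After a pop the stack is empty, so that the    *)
(* next input element is then always pushed: the second branch performs both  *)
(* operations, which makes the recursion structural. The one-operation-at-    *)
(* a-time description is [hare_output_step].                                  *)
Fixpoint hare_output (stack input : seq nat) : seq nat :=
  match input with
  | [::] => stack
  | x :: input' =>
      if avoids (x :: stack) [:: 2; 1] then hare_output (x :: stack) input'
      else stack ++ hare_output [:: x] input'
  end.

Lemma avoids21_seq1 x : avoids [:: x] [:: 2; 1].
Proof.
apply/containsP => -[s /size_subseq le1 /andP[/eqP sz _]].
by rewrite sz in le1.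
Qed.

Lemma hare_output_step stack x input :
  hare_output stack (x :: input) =
    if avoids (x :: stack) [:: 2; 1] then hare_output (x :: stack) input
    else stack ++ hare_output [::] (x :: input).
Proof. by rewrite /= avoids21_seq1. Qed.

Definition hare_sortable (w : seq nat) : bool :=
  sorted leq (hare_output [::] w).

(* Main.v *)
(** The stack is always weakly increasing from top to bottom, so the machine
    reverses each maximal weakly decreasing run of the input, and the output is
    sorted iff no entry of a run exceeds an entry of a later run.  If this
    holds, a subsequence whose first entry exceeds its last one stays inside a
    single run and is weakly decreasing, which rules out 231, 312 and 2121.
    Conversely, let [a] be an entry of a run with last entry [l], let [x > l] be
    the first entry of the next run, and suppose [a > b] for an entry [b] from
    [x] on.  Comparing [a] with [x], and if they are equal [l] with [b], yields
    one of the three patterns inside [a l x b]. *)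

Require Import Defs.
From mathcomp Require Import all_boot zify.

Lemma containsE w p s : subseq s w -> order_isomorphic s p -> contains w p.
Proof. by move=> sub_sw iso_sp; apply/containsP; exists s. Qed.

Lemma order_isomorphic21 x y : order_isomorphic [:: x; y] [:: 2; 1] = (y < x).
Proof. by rewrite /order_isomorphic /allrel /= !ltnn !eqxx; lia. Qed.

Lemma order_isomorphic231 x y z :
  order_isomorphic [:: x; y; z] [:: 2; 3; 1] = (z < x < y).
Proof. by rewrite /order_isomorphic /allrel /= !ltnn !eqxx; lia. Qed.

Lemma order_isomorphic312 x y z :
  order_isomorphic [:: x; y; z] [:: 3; 1; 2] = (y < z < x).
Proof. by rewrite /order_isomorphic /allrel /= !ltnn !eqxx; lia. Qed.

Lemma order_isomorphic2121 x y z t :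
  order_isomorphic [:: x; y; z; t] [:: 2; 1; 2; 1] =
  [&& y < x, z == x & t == y].
Proof. by rewrite /order_isomorphic /allrel /= !ltnn !eqxx; lia. Qed.

Lemma order_isomorphic_size s p : order_isomorphic s p -> size s = size p.
Proof. by case/andP => /eqP. Qed.

Lemma avoids_subseq v w p : subseq v w -> avoids w p -> avoids v p.
Proof.
move=> sub_vw; apply: contra => /containsP[s sub_sv].
exact/containsE/(subseq_trans sub_sv).
Qed.

(** An occurrence of 21 is a pair of entries in strictly decreasing order, so by transitivity of
    [leq] only adjacent entries need checking. *)
Lemma avoids21E w : avoids w [:: 2; 1] = sorted leq w.
Proof.
apply/idP/idP => [|w_sorted]; last first.
  apply/containsP => -[[|x [|y [|? ?]]] sub_sw iso];
    have := order_isomorphic_size _ _ iso => // _.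
  have := subseq_sorted leq_trans sub_sw w_sorted.
  by move: iso; rewrite order_isomorphic21 /=; lia.
rewrite (sorted_pairwise leq_trans); elim: w => //= x w IHw av_xw.
rewrite IHw ?andbT; last exact: avoids_subseq (subseq_cons _ _) av_xw.
apply/allP => y y_w; rewrite leqNgt; apply: contra av_xw => lt_yx.
by apply: (@containsE _ _ [:: x; y]);
  rewrite ?order_isomorphic21 //= eqxx sub1seq.
Qed.

Lemma perm_hare_output st w : perm_eq (hare_output st w) (st ++ w).
Proof.
elim: w st => [|x w IHw] st /=; first by rewrite cats0.
case: ifP => _; last by rewrite perm_cat2l (perm_trans (IHw _)).
by apply: perm_trans (IHw _) _; rewrite (perm_catCA [:: x] st w).
Qed.

(** The later output is a rearrangement of [x :: w], so comparing it with the popped block amounts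
    to comparing that block with the remaining input. *)
Lemma sorted_hare_output_pop st x w : sorted leq st ->
  sorted leq (st ++ hare_output [:: x] w) =
  allrel leq st (x :: w) && sorted leq (hare_output [:: x] w).
Proof.
rewrite !(sorted_pairwise leq_trans) pairwise_cat => ->; congr (_ && _).
apply: eq_all => y; apply: perm_all; exact: perm_hare_output.
Qed.

Lemma subseq_catP (T : eqType) (s u v : seq T) :
  subseq s (u ++ v) ->
  exists s1 s2, [/\ s = s1 ++ s2, subseq s1 u & subseq s2 v].
Proof.
case/subseqP => m sz_m ->.
exists (mask (take (size u) m) u), (mask (drop (size u) m) v).
rewrite -mask_cat ?cat_take_drop ?mask_subseq //.
by rewrite size_takel // sz_m size_cat leq_addr.
Qed.

(** The word [rev st ++ w] lists the entries in input order from the last pop on, so a push leaves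
    it unchanged. The strict inequality excludes the empty [s], where both defaults are 0. *)
Lemma hare_output_sorted_subseq st w s :
    sorted leq st -> sorted leq (hare_output st w) ->
    subseq s (rev st ++ w) -> last 0 s < head 0 s ->
  sorted geq s.
Proof.
have geq_trans : transitive geq by move=> n m p /= le_nm /leq_trans->.
elim: w st s => [|x w IHw] st s st_sorted /=.
  by rewrite cats0 => _ /(subseq_sorted geq_trans)->; rewrite ?rev_sorted.
rewrite avoids21E; case: ifP => [xst_sorted out_sorted|_].
  by rewrite -cat_rcons -rev_cons; apply: IHw.
rewrite sorted_hare_output_pop // => /andP[/allrelP le_st out_sorted].
case/subseq_catP => s1 [s2 [-> sub1 sub2]].
(* At a pop, [s] lies in the remaining input, or in the popped run, which is decreasing in input
   order, or else it meets both; then its first entry is at most its last. *)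
case: s1 sub1 => [|y s1] sub1; first exact: (IHw [:: x]).
case/lastP: s2 sub2 => [|s2 z] sub2.
  by rewrite cats0 => _; apply: (subseq_sorted geq_trans sub1);
    rewrite rev_sorted.
have y_st : y \in st by rewrite -mem_rev (mem_subseq sub1) ?mem_head.
have z_w : z \in x :: w by rewrite (mem_subseq sub2) // mem_rcons mem_head.
by rewrite last_cat last_rcons /= ltnNge le_st.
Qed.

Lemma sorted_hare_output st w : sorted leq st ->
    avoids (rev st ++ w) [:: 2; 3; 1] -> avoids (rev st ++ w) [:: 3; 1; 2] ->
    avoids (rev st ++ w) [:: 2; 1; 2; 1] ->
  sorted leq (hare_output st w).
Proof.
elim: w st => [|x w IHw] st //= st_sorted av231 av312 av2121.
rewrite avoids21E; case: ifP => [xst_sorted|].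
  by apply: IHw => //; rewrite rev_cons cat_rcons.
rewrite sorted_hare_output_pop // => /negbT xst_unsorted.
have sub_xw : subseq (x :: w) (rev st ++ x :: w) by apply: suffix_subseq.
rewrite IHw ?andbT //; try exact: avoids_subseq sub_xw _.
(* An empty stack never forces a pop, so there is a top [l], the last entry of the run in input
   order, and [l < x]. *)
case: st st_sorted av231 av312 av2121 xst_unsorted {sub_xw} => //= l st.
move=> lst_sorted av231 av312 av2121.
rewrite lst_sorted andbT -ltnNge => lt_lx.
apply/allrelP => a b a_st b_w; rewrite leqNgt; apply/negP => lt_ba.
have no_pattern p s1 s2 : avoids (rev (l :: st) ++ x :: w) p ->
    subseq s1 (rev (l :: st)) -> subseq s2 (x :: w) ->
  ~~ order_isomorphic (s1 ++ s2) p.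
  by move=> av_p sub1 sub2; apply: contra av_p; apply/containsE/cat_subseq.
have sub_a : subseq [:: a] (rev (l :: st)) by rewrite sub1seq mem_rev.
have sub_al : a != l -> subseq [:: a; l] (rev (l :: st)).
  move=> ne_al; rewrite rev_cons -cats1 (@cat_subseq _ [:: a] [:: l]) //.
  by move: a_st; rewrite sub1seq mem_rev inE (negPf ne_al).
have sub_xb : b != x -> subseq [:: x; b] (x :: w).
  by move=> ne_bx; move: b_w; rewrite /= eqxx sub1seq inE (negPf ne_bx).
have sub_b : subseq [:: b] (x :: w) by rewrite sub1seq.
have sub_x : subseq [:: x] (x :: w) by rewrite sub1seq mem_head.
case: (ltngtP a x) => [lt_ax|lt_xa|eq_ax].
- have := no_pattern _ _ _ av231 sub_a (sub_xb _).
  by rewrite order_isomorphic231; lia.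
- have := no_pattern _ _ _ av312 (sub_al _) sub_x.
  by rewrite order_isomorphic312; lia.
have ne_al : a != l by lia.
have ne_bx : b != x by lia.
(* With [a = x], the three cases give 312 in [a l b], 231 in [l x b], and 2121 in [a l x b]. *)
case: (ltngtP l b) => [lt_lb|lt_bl|eq_lb].
- have := no_pattern _ _ _ av312 (sub_al ne_al) sub_b.
  by rewrite order_isomorphic312; lia.
- have sub_l := subseq_trans (suffix_subseq [:: a] [:: l]) (sub_al ne_al).
  have := no_pattern _ _ _ av231 sub_l (sub_xb ne_bx).
  by rewrite order_isomorphic231; lia.
have := no_pattern _ _ _ av2121 (sub_al ne_al) (sub_xb ne_bx).
by rewrite order_isomorphic2121; lia.
Qed.

Theorem theorem9 (w : seq nat) (cayley_w : cayley_permutation w) :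
  hare_sortable w <->
  [/\ avoids w [:: 2; 3; 1], avoids w [:: 3; 1; 2] & avoids w [:: 2; 1; 2; 1]].
Proof.
split=> [w_sortable|[]]; last exact: (@sorted_hare_output [::]).
have geq_sub s := @hare_output_sorted_subseq [::] w s isT w_sortable.
(* Each pattern ends below its first entry yet contains an ascent, contradicting [geq_sub]. *)
split; apply/containsP => -[s sub_sw iso];
  have := order_isomorphic_size _ _ iso; have := geq_sub s sub_sw; move: iso.
- case: s {sub_sw} => [|x [|y [|z [|? ?]]]] //.
  by rewrite order_isomorphic231 /= /geq /=; lia.
- case: s {sub_sw} => [|x [|y [|z [|? ?]]]] //.
  by rewrite order_isomorphic312 /= /geq /=; lia.
- case: s {sub_sw} => [|x [|y [|z [|t [|? ?]]]]] //.
  by rewrite order_isomorphic2121 /= /geq /=; lia.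
Qed.
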